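(* Let $R=k[[x_1,\dots,x_n]]$, let $I\subset R$ be a monomial ideal and let $m\ge 0$ be an integer. Then the $m$-th jet support closure $I^{m\text{-}jsc}$ is also a monomial ideal, and for $b_1,\dots,b_n\in\mathbb Z_{\ge 0}$ the monomial $x_1^{b_1}\cdots x_n^{b_n}$ belongs to $I^{m\text{-}jsc}$ if and only if for all positive integers $t_1,\dots,t_n$ satisfying $t_1b_1+t_2b_2+\cdots+t_nb_n\le m$ there exists a monomial $x_{i_1}^{a_1}\cdots x_{i_s}^{a_s}\in I$ (with $i_1,\dots,i_s$ distinct) such that $t_{i_1}a_1+\cdots+t_{i_s}a_s\le m$.
   Context: $k$ is an algebraically closed field of characteristic $0$. For an integer $m\ge 0$ put $P_m=k[x_i^{(j)}: 1\le i\le n,\ 1\le j\le m]$. For $g\in R=k[[x_1,\dots,x_n]]$ define $D_0(g),\dots,D_m(g)\in P_m$ by $$g\Big(\sum_{j=1}^m x_1^{(j)}t^j,\dots,\sum_{j=1}^m x_n^{(j)}t^j\Big)\equiv\sum_{j=0}^m D_j(g)\,t^j \pmod{t^{m+1}}.$$ For an ideal $I\subset R$ let $\overline{I}_m\subset P_m$ be the ideal generated by all $D_j(g)$ with $g\in I$, $0\le j\le m$. (Here $P_m$ is the $m$-th jet ring $R_m$ modulo $\mathfrak m R_m$, with $\mathfrak m$ the maximal ideal of $R$, and $\overline I_m$ is the image of the $m$-th jet ideal of $I$.) The $m$-th jet support closure of $I$ is $$I^{m\text{-}jsc}=\Big\{f\in R: D_j(f)\in \sqrt{\overline I_m} \text{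 for all } 0\le j\le m\Big\}.$$ *)

(* Defs.v *)
From HB Require Import structures.
From mathcomp Require Import all_boot all_order all_algebra.
From mathcomp.classical Require Import boolp.
From mathcomp.multinomials Require Import mpoly.

Set Implicit Arguments.
Unset Strict Implicit.
Unset Printing Implicit Defensive.

Import GRing.Theory.
Local Open Scope ring_scope.

Section IdealDefs.
Variable A : comNzRingType.

Definition ideal_gen (G : A -> Prop) (f : A) : Prop :=
  exists s : seq (A * A),
    (forall p, p \in s -> G p.2) /\ f = \sum_(p <- s) p.1 * p.2.

Definition radical (J : A -> Prop) (f : A) : Prop :=
  exists2 N : nat, (0 < N)%N & J (f ^+ N).

Definition is_ideal (J : A -> Prop) : Prop :=
  [/\ J 0, forall f g, J f -> J g -> J (f + g) & forall r f, J f -> J (r * f)].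

Lemma ideal_genP (G : A -> Prop) :
  [/\ is_ideal (ideal_gen G), forall g, G g -> ideal_gen G g &
      forall J, is_ideal J -> (forall g, G g -> J g) ->
        forall f, ideal_gen G f -> J f].
Proof.
split; first split.
- by exists [::]; split => //; rewrite big_nil.
- move=> f g [s [Hs ->]] [u [Hu ->]]; exists (s ++ u); split; last by rewrite big_cat.
  by move=> p; rewrite mem_cat => /orP[/Hs|/Hu].
- move=> r f [s [Hs ->]]; exists [seq (r * p.1, p.2) | p <- s]; split.
    by move=> p /mapP[q /Hs Hq ->].
  by rewrite big_map mulr_sumr; apply: eq_bigr => p _; rewrite mulrA.
- move=> g Hg; exists [:: (1, g)]; split; last by rewrite big_seq1 mul1r.
  by move=> p; rewrite inE => /eqP ->.
- move=> J [J0 JD JM] HG f [s [Hs ->]].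
  rewrite big_seq; elim/big_rec: _ => // p x /Hs/HG Hp Hx.
  by apply: JD => //; apply: JM.
Qed.

End IdealDefs.

(* Formal power series k[[x_1, ..., x_n]] as coefficient families.            *)
Record mseries (n : nat) (k : comNzRingType) :=
  MSeries { mscoef : 'X_{1..n} -> k }.
Arguments MSeries {n k}.

Section MSeriesRing.
Variables (n : nat) (k : comNzRingType).
Implicit Types f g h : mseries n k.

HB.instance Definition _ := gen_eqMixin (mseries n k).
HB.instance Definition _ := gen_choiceMixin (mseries n k).

Lemma mseriesP f g : (forall a, mscoef f a = mscoef g a) -> f = g.
Proof. by case: f g => [f] [g] /= fg; congr MSeries; apply/funext. Qed.

Definition ms_zero : mseries n k := MSeries (fun=> 0).
Definition ms_opp f := MSeries (fun a => - mscoef f a).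
Definition ms_add f g := MSeries (fun a => mscoef f a + mscoef g a).

Definition msX (b : 'X_{1..n}) : mseries n k :=
  MSeries (fun a => (b == a)%:R).

Definition ms_mul f g := MSeries (fun a =>
  \sum_(c : 'X_{1..n < (mdeg a).+1, (mdeg a).+1} | a == (c.1 + c.2)%MM)
     mscoef f c.1 * mscoef g c.2).

Lemma ms_addA : associative ms_add.
Proof. by move=> f g h; apply: mseriesP => a /=; rewrite addrA. Qed.
Lemma ms_addC : commutative ms_add.
Proof. by move=> f g; apply: mseriesP => a /=; rewrite addrC. Qed.
Lemma ms_add0 : left_id ms_zero ms_add.
Proof. by move=> f; apply: mseriesP => a /=; rewrite add0r. Qed.
Lemma ms_addN : left_inverse ms_zero ms_opp ms_add.
Proof. by move=> f; apply: mseriesP => a /=; rewrite addNr. Qed.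

HB.instance Definition _ := GRing.isZmodule.Build (mseries n k)
  ms_addA ms_addC ms_add0 ms_addN.

Definition ms_trunc (d : nat) f : {mpoly k[n]} :=
  \sum_(a : 'X_{1..n < d}) mscoef f a *: 'X_[a].

Lemma ms_truncE d f (a : 'X_{1..n}) :
  (mdeg a < d)%N -> (ms_trunc d f)@_a = mscoef f a.
Proof. exact: mcoeff_mpoly. Qed.

Lemma ms_mulE (p q : {mpoly k[n]}) f g (a : 'X_{1..n}) :
    (forall c : 'X_{1..n}, (mdeg c <= mdeg a)%N -> p@_c = mscoef f c) ->
    (forall c : 'X_{1..n}, (mdeg c <= mdeg a)%N -> q@_c = mscoef g c) ->
  mscoef (ms_mul f g) a = (p * q)@_a.
Proof.
move=> pf qg; rewrite mcoeffM; apply: eq_bigr => c _.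
by rewrite pf ?qg // -ltnS; exact: bmdeg.
Qed.

Let T f (a : 'X_{1..n}) := ms_trunc (mdeg a).+1 f.
Let TE f (a c : 'X_{1..n}) :
  (mdeg c <= mdeg a)%N -> (T f a)@_c = mscoef f c.
Proof. by move=> ca; rewrite ms_truncE. Qed.
Let TM f g (a c : 'X_{1..n}) : (mdeg c <= mdeg a)%N ->
  (T f a * T g a)@_c = mscoef (ms_mul f g) c.
Proof.
by move=> ca; symmetry; apply: ms_mulE => e ec; apply: TE; exact: leq_trans ca.
Qed.

Lemma ms_mulC : commutative ms_mul.
Proof. by move=> f g; apply: mseriesP => a; rewrite -!(TM _ _ (leqnn (mdeg a))) mulrC. Qed.

Lemma ms_mulA : associative ms_mul.
Proof.
move=> f g h; apply: mseriesP => a.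
rewrite (@ms_mulE (T f a) (T g a * T h a)) ?mulrA.
- symmetry; apply: ms_mulE; [exact: TM | exact: TE].
- exact: TE.
- exact: TM.
Qed.

Lemma ms_mul1 : left_id (msX 0%MM) ms_mul.
Proof.
move=> f; apply: mseriesP => a; rewrite (@ms_mulE 'X_[0%MM] (T f a)).
- by rewrite mpolyX0 mul1r TE.
- by move=> c _; rewrite mcoeffX.
- exact: TE.
Qed.

Lemma ms_mulDl : left_distributive ms_mul ms_add.
Proof.
move=> f g h; apply: mseriesP => a; rewrite /= -big_split /=.
by apply: eq_bigr => c _; rewrite mulrDl.
Qed.

Lemma ms_one_neq0 : msX 0%MM != ms_zero.
Proof.
apply/eqP => /(congr1 (fun f => mscoef f 0%MM)) /= /eqP.
by rewrite eqxx oner_eq0.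
Qed.

HB.instance Definition _ := GRing.Zmodule_isComNzRing.Build (mseries n k)
  ms_mulA ms_mulC ms_mul1 ms_mulDl ms_one_neq0.

Definition monomial_ideal (I : mseries n k -> Prop) : Prop :=
  exists S : 'X_{1..n} -> Prop,
    forall f, I f <-> ideal_gen (fun g => exists2 a, S a & g = msX a) f.

End MSeriesRing.

Arguments msX {n k} b.

Section Jets.
Variables (n : nat) (k : comNzRingType) (m : nat).

Local Notation jet_ring := {mpoly k[n * m]}.

(* x_i^(j), for 1 <= j <= m, is the variable 'X_(mxvec_index i l), where the  *)
(* index l : 'I_m has value j - 1.                                            *)
Definition jet_arc (i : 'I_n) : {poly jet_ring} :=
  \sum_(l < m) 'X_(mxvec_index i l) *: 'X^(l.+1).

Definition jet_subst (N : nat) (g : mseries n k) : {poly jet_ring} :=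
  \sum_(a : 'X_{1..n < N})
     (mscoef g a)%:MP *: \prod_(i < n) jet_arc i ^+ a i.

(* Every jet_arc i is divisible by t, so monomials of degree > m do not       *)
(* contribute modulo t^(m+1); see jet_coef_stable.                            *)
Definition jet_coef (j : nat) (g : mseries n k) : jet_ring :=
  (jet_subst m.+1 g)`_j.

Lemma jet_monom_coef0 (a : 'X_{1..n}) (j : nat) : (j < mdeg a)%N ->
  (\prod_(i < n) jet_arc i ^+ a i)`_j = 0.
Proof.
pose q i : {poly jet_ring} :=
  \sum_(l < m) 'X_(mxvec_index i l) *: 'X^l.
have arcE i : jet_arc i = q i * 'X.
  by rewrite mulr_suml; apply: eq_bigr => l _; rewrite -scalerAl -exprSr.
move=> ja; under eq_bigr => i _ do rewrite arcE exprMn.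
by rewrite big_split /= prodrXr -mdegE coefMXn ja.
Qed.

Lemma jet_coef_stable (N j : nat) (g : mseries n k) :
  (j <= m)%N -> (m < N)%N -> (jet_subst N g)`_j = jet_coef j g.
Proof.
move=> jm mN; rewrite /jet_coef /jet_subst !coef_sum.
pose F (a : 'X_{1..n}) : jet_ring :=
  ((mscoef g a)%:MP *: \prod_(i < n) jet_arc i ^+ a i)`_j.
have F0 a : (j < mdeg a)%N -> F a = 0.
  by move=> ja; rewrite /F coefZ jet_monom_coef0 ?mulr0.
pose r M := [seq bmnm a | a : 'X_{1..n < M}].
have sumE M : \sum_(a : 'X_{1..n < M}) F a =
    \sum_(a <- r M | (mdeg a <= j)%N) F a.
  rewrite big_map big_enum_cond /=.
  rewrite [RHS]big_mkcond; apply: eq_bigr => a _.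
  by case: leqP => // /F0.
have mem_r M a : (a \in r M) = (mdeg a < M)%N.
  apply/mapP/idP => [[b _ ->]|aM]; first exact: bmdeg.
  by exists (BMultinom aM); rewrite ?mem_enum.
rewrite (sumE N) (sumE m.+1) -[LHS]big_filter -[RHS]big_filter.
apply: perm_big; apply: uniq_perm.
- by rewrite filter_uniq // map_inj_uniq ?enum_uniq //; exact: val_inj.
- by rewrite filter_uniq // map_inj_uniq ?enum_uniq //; exact: val_inj.
move=> a; rewrite !mem_filter !mem_r; case: (leqP (mdeg a) j) => //= aj.
have am := leq_ltn_trans (leq_trans aj jm) (ltnSn m).
by rewrite am (leq_trans am mN).
Qed.

Definition jet_ideal (I : mseries n k -> Prop) : jet_ring -> Prop :=
  ideal_gen (fun P : jet_ring =>
    exists j g, [/\ (j <= m)%N, I g & P = jet_coef j g]).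

Definition jet_support_closure (I : mseries n k -> Prop) :
    mseries n k -> Prop :=
  fun f => forall j, (j <= m)%N -> radical (jet_ideal I) (jet_coef j f).

End Jets.

(* Main.v *)
Require Import Defs.
From mathcomp Require Import all_boot all_order all_algebra.
From mathcomp.multinomials Require Import mpoly.
From mathcomp.classical Require Import boolp.
From mathcomp Require Import ring zify.

(** Write [weight t a] for the sum of the t_i a_i, and call a vector t of
    positive integers admissible when [weight t a > m] for every monomial x^a
    of I.  Everything follows from the description of the closure as the set
    of series f each of whose monomials x^b satisfies [weight t b > m] for all
    admissible t ([jet_support_closure_supp]).

    This set does not see the values of the nonzero coefficients, and it
    contains x^b as soon as [mdeg b > m].  Hence the exponents of degree at
    most m + 1 already generate it, and since there are finitely many of them,
    it is a monomial ideal in the algebraic sense, with finite sums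
    ([supp_ideal_gen]).  The criterion for a single x^b is the contrapositive
    of its definition.

    The closure is no larger: for admissible t, specializing the jet variables
    to the arc (x_1 T^(t_1), ..., x_n T^(t_n)) maps the jet ideal to zero in
    the domain k[x_1, ..., x_n], hence also its radical.  The image of D_j(f)
    is the part of f of weight j ([monomial_arc_coef]), so f has no monomial
    of weight at most m.

    It is no smaller: the arcs with ord x_i >= t_i form a closed stratum,
    cut out in the jet scheme by the jet ideal together with the
    x_i^(j), j < t_i.  If every monomial of f has weight > m, then D_j(f)
    vanishes on the stratum of t.  It remains to see that
    the jet scheme is covered by the strata of admissible t
    ([radical_stratum]).  If t is not admissible, some x^a in I has weight
    w <= m, and on the stratum of t the equation D_w(x^a) = 0 reads
    prod_i (x_i^(t_i))^(a_i) = 0.  So the stratum is the union of its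
    hyperplane sections x_i^(t_i) = 0 with a_i > 0, each of which is the
    stratum of t with t_i raised by one.  Since t_i <= w <= m for these i, the
    process stops.  The covering is expressed algebraically: a polynomial in
    the ideals of all admissible strata has a power in the jet ideal. *)

Set Implicit Arguments.
Unset Strict Implicit.
Unset Printing Implicit Defensive.

Import GRing.Theory.
Local Open Scope ring_scope.

(** * Ideals and radicals *)

Section Ideals.
Variable A : comNzRingType.
Implicit Types (J : A -> Prop) (f g x : A).

Lemma is_ideal_gen (G : A -> Prop) : is_ideal (ideal_gen G).
Proof. by case: (ideal_genP G). Qed.

Lemma mem_ideal_gen (G : A -> Prop) g : G g -> ideal_gen G g.
Proof. by case: (ideal_genP G) => _ + _; apply. Qed.

Lemma ideal_gen_min (G J : A -> Prop) :
  is_ideal J -> (forall g, G g -> J g) -> forall f, ideal_gen G f -> J f.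
Proof. by case: (ideal_genP G) => _ _; apply. Qed.

Section OneIdeal.
Variables (J : A -> Prop) (idJ : is_ideal J).

Lemma ideal0 : J 0. Proof. by case: idJ. Qed.

Lemma idealD f g : J f -> J g -> J (f + g).
Proof. by case: idJ => _ + _; apply. Qed.

Lemma idealM x f : J f -> J (x * f).
Proof. by case: idJ => _ _; apply. Qed.

Lemma idealB f g : J f -> J g -> J (f - g).
Proof. by move=> Jf Jg; rewrite -mulN1r; apply: idealD => //; apply: idealM. Qed.

Lemma ideal_subr f g : J (f - g) -> J f -> J g.
Proof. by move=> Jfg Jf; rewrite -(subKr f g); apply: idealB. Qed.

Lemma ideal_sum (I : Type) (r : seq I) (P : pred I) (F : I -> A) :
  (forall i, P i -> J (F i)) -> J (\sum_(i <- r | P i) F i).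
Proof. by move=> JF; elim/big_rec: _ => [|i x /JF]; [apply: ideal0|apply: idealD]. Qed.

Lemma ideal_congrM f f' g g' : J (f - f') -> J (g - g') -> J (f * g - f' * g').
Proof.
move=> Jf Jg; have -> : f * g - f' * g' = f * (g - g') + g' * (f - f') by ring.
by apply: idealD; apply: idealM.
Qed.

Lemma ideal_congrX f f' d : J (f - f') -> J (f ^+ d - f' ^+ d).
Proof. by move=> Jf; rewrite subrXX mulrC; apply: idealM. Qed.

Lemma ideal_congr_prod (I : Type) (r : seq I) (F F' : I -> A) :
  (forall i, J (F i - F' i)) -> J (\prod_(i <- r) F i - \prod_(i <- r) F' i).
Proof.
move=> JF; elim/big_rec2: _ => [|i x y _ Jxy]; first by rewrite subrr; apply: ideal0.
exact: ideal_congrM.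
Qed.

(** The ideal J + (x). *)
Definition adjoin x f := exists c, J (f - c * x).

Lemma is_ideal_adjoin x : is_ideal (adjoin x).
Proof.
split=> [|f g [c Jc] [d Jd]|h f [c Jc]].
- by exists 0; rewrite mul0r subrr; apply: ideal0.
- exists (c + d); have -> : f + g - (c + d) * x = f - c * x + (g - d * x) by ring.
  exact: idealD.
- exists (h * c); have -> : h * f - h * c * x = h * (f - c * x) by ring.
  exact: idealM.
Qed.

Lemma sub_adjoin x f : J f -> adjoin x f.
Proof. by move=> Jf; exists 0; rewrite mul0r subr0. Qed.

Lemma mem_adjoin x : adjoin x x.
Proof. by exists 1; rewrite mul1r subrr; apply: ideal0. Qed.

(** Multiplying f^N = c x and f^M = d y modulo J: the closed set cut out by
    x y is covered by those of x and of y.  The exponents may vanish, which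
    gives a unit for the induction over products. *)
Lemma radical_adjoinM f x y :
  (exists N, adjoin x (f ^+ N)) -> (exists N, adjoin y (f ^+ N)) ->
  exists N, adjoin (x * y) (f ^+ N).
Proof.
move=> [N [c Jc]] [M [d Jd]]; exists (N + M)%N; exists (c * d).
have -> : f ^+ (N + M) - c * d * (x * y) = (f ^+ N * f ^+ M - (c * x) * (d * y)).
  by rewrite exprD; ring.
exact: ideal_congrM.
Qed.

(** When J contains a product of powers, its zero set is the union of the
    zero sets of the factors, so radical membership is tested on each factor.
    Factors with exponent 0 are equal to 1 and impose nothing. *)
Lemma radical_adjoin_prod f (I : Type) (r : seq I) (x : I -> A) (a : I -> nat) :
  (forall i, (0 < a i)%N -> exists N, adjoin (x i) (f ^+ N)) ->
  J (\prod_(i <- r) x i ^+ a i) -> exists N, J (f ^+ N).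
Proof.
move=> Hx Jprod.
have [N [c Jc]] : exists N, adjoin (\prod_(i <- r) x i ^+ a i) (f ^+ N).
  have adj1 : exists N, adjoin 1 (f ^+ N).
    by exists 0, 1; rewrite expr0 mulr1 subrr; apply: ideal0.
  elim/big_ind: _ => // [y z|i _]; first exact: radical_adjoinM.
  case: (posnP (a i)) => [->|/Hx Hi]; first by rewrite expr0.
  elim: (a i) => [|d IHd]; first by rewrite expr0.
  by rewrite exprS; apply: radical_adjoinM.
exists N; rewrite -(subrK (c * \prod_(i <- r) x i ^+ a i) (f ^+ N)).
by apply: idealD => //; apply: idealM.
Qed.

(** Congruence of polynomials modulo J[T] is therefore multiplicative, which
    lets arcs be replaced by congruent arcs inside products. *)
Lemma is_ideal_coefs : is_ideal (fun p : {poly A} => forall i, J p`_i).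
Proof.
split=> [i|p q Jp Jq i|p q Jq i]; first by rewrite coef0; apply: ideal0.
  by rewrite coefD; apply: idealD.
by rewrite coefM; apply: ideal_sum => l _; apply: idealM.
Qed.

End OneIdeal.
End Ideals.

Lemma is_ideal_ker (A B : comNzRingType) (f : {rmorphism A -> B}) :
  is_ideal (fun x => f x = 0).
Proof.
split=> [|x y fx fy|x y fy]; first exact: rmorph0.
  by rewrite rmorphD fx fy addr0.
by rewrite rmorphM fy mulr0.
Qed.

(** * Monomial ideals of power series *)

Section Monomial.
Variables (n : nat) (k : comNzRingType).
Implicit Types (a b : 'X_{1..n}) (f g : mseries n k) (B : 'X_{1..n} -> Prop).

Definition upward_closed B := forall a b, B a -> B (a + b)%MM.

Lemma mscoef_msX a b : mscoef (msX b : mseries n k) a = (b == a)%:R.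
Proof. by []. Qed.

Lemma msXD a b : msX (a + b)%MM = msX a * msX b :> mseries n k.
Proof.
apply: mseriesP => c; rewrite (@ms_mulE _ _ 'X_[a] 'X_[b]) => [|d _|d _].
- by rewrite -mpolyXD mcoeffX.
- exact: mcoeffX.
- exact: mcoeffX.
Qed.

Lemma mscoef_mulX g b a :
  mscoef (g * msX b) a = if (b <= a)%MM then mscoef g (a - b)%MM else 0.
Proof.
rewrite (@ms_mulE _ _ (ms_trunc (mdeg a).+1 g) 'X_[b]) => [|c ca|c _]; last exact: mcoeffX.
  case: ifP => [ba|nba].
    by rewrite -[X in _@_X = _](submK ba) addmC mcoeffMX ms_truncE // ltnS mdegB.
  rewrite mcoeffM big1 // => c /eqP ac; rewrite mcoeffX.
  case: eqP => [bc|]; last by rewrite mulr0.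
  by case/negP: (negbT nba); rewrite bc [X in (_ <= X)%MM]ac lem_addl.
by rewrite ms_truncE.
Qed.

Lemma is_ideal_supp B : upward_closed B ->
  is_ideal (fun f => forall a, mscoef f a != 0 -> B a).
Proof.
move=> Bup; split=> [a|f g Bf Bg a|r f Bf a]; first by rewrite eqxx.
  have [/eqP f0|/Bf //] := boolP (mscoef f a == 0).
  by move=> fg; apply: Bg; move: fg; rewrite /= f0 add0r.
apply: contra_neqP => nBa; rewrite [LHS]big1 // => c /eqP ac.
have [/eqP->|/Bf Bc] := boolP (mscoef f c.2 == 0); first by rewrite mulr0.
by case: nBa; rewrite ac addmC; apply: Bup.
Qed.

Lemma exists_mdeg_divisor d a :
  (d <= mdeg a)%N -> exists2 b, (b <= a)%MM & mdeg b = d.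
Proof.
elim: d => [_|d IHd da]; first by exists 0%MM; rewrite ?mdeg0 //; apply/mnm_lepP=> i; rewrite mnm0E.
have [b ba bd] := IHd (ltnW da).
have [i ibi] : exists i, (b i < a i)%N.
  apply/existsP; apply: contraLR da => /existsPn nba.
  rewrite -leqNgt -bd !mdegE; apply: leq_sum => i _.
  by rewrite leqNgt.
exists (b + U_(i))%MM; last by rewrite mdegD mdeg1 bd addn1.
apply/mnm_lepP => j; rewrite mnmDE mnm1E.
by case: eqP => [<-|_]; rewrite ?addn1 // addn0; apply/mnm_lepP.
Qed.

(** The support condition describes an ideal closed under infinite sums, while
    [ideal_gen] only has finite ones.  The hypothesis on degree d makes up for
    it: every exponent has a divisor rho a of degree at most d which is in B
    when a is, and grouping the terms of f by rho a writes f as a sum over the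
    finitely many exponents of degree at most d. *)
Lemma supp_ideal_gen d B f : upward_closed B -> (forall a, mdeg a = d -> B a) ->
  (forall a, mscoef f a != 0 -> B a) <->
  ideal_gen (fun g => exists2 a, B a & g = msX a) f.
Proof.
move=> Bup Bd; split; last first.
  apply: (ideal_gen_min (is_ideal_supp Bup)) => _ [a Ba ->] b.
  by rewrite mscoef_msX; case: (a =P b) => [<-|_]; rewrite ?eqxx.
move=> Bf.
have /boolp.choice[rho rhoP] a : exists b : 'X_{1..n},
    (b <= a)%MM /\ if (mdeg a <= d)%N then b = a else mdeg b = d.
  case: leqP => [_|/ltnW/exists_mdeg_divisor[b ba bd]].
    by exists a; rewrite lepm_refl.
  by exists b.
have rho_lt a : (mdeg (rho a) < d.+1)%N.
  by case: (rhoP a) => _; case: ifP => [ad ->|_ ->].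
pose g b : mseries n k :=
  MSeries (fun c => if rho (c + b)%MM == b then mscoef f (c + b)%MM else 0).
have -> : f = \sum_(b : 'X_{1..n < d.+1} | `[< B b >]) g b * msX b.
  have coef_sum (P : pred 'X_{1..n < d.+1}) (F : 'X_{1..n < d.+1} -> mseries n k) a :
      mscoef (\sum_(b | P b) F b) a = \sum_(b | P b) mscoef (F b) a.
    exact: (big_morph (fun h => mscoef h a) (fun _ _ => erefl) erefl).
  apply: mseriesP => a; rewrite coef_sum.
  (* Each exponent a contributes to the single summand b = rho a. *)
  have gE (b : 'X_{1..n < d.+1}) :
      mscoef (g b * msX b) a = if rho a == b then mscoef f a else 0.
    rewrite mscoef_mulX; case: ifP => [ba|nba]; first by rewrite /= submK.
    by case: eqP => // rab; move: nba; rewrite -rab; case: (rhoP a) => ->.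
  under eq_bigr do rewrite gE.
  have [Brho|nBrho] := pselect (B (rho a)).
    rewrite (bigD1 (BMultinom (rho_lt a))) /=; last exact/asboolP.
    rewrite eqxx big1 ?addr0 // => b /andP[_ nb]; case: eqP => // rab.
    by case/eqP: nb; apply: val_inj.
  rewrite big1 => [|b /asboolP Bb]; last by case: eqP => // rab; rewrite rab in nBrho.
  apply/eqP; apply: contra_notT nBrho => /Bf Ba.
  by case: (rhoP a) => _; case: ifP => [_ ->|_ /Bd].
apply: (ideal_sum (is_ideal_gen _)) => b /asboolP Bb.
by apply: (idealM (is_ideal_gen _)); apply: mem_ideal_gen; exists (val b).
Qed.

(** A monomial ideal contains every monomial occurring in one of its elements;
    this reduces conditions on all of I to conditions on its monomials. *)
Lemma monomial_ideal_supp (I : mseries n k -> Prop) : monomial_ideal I ->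
  [/\ is_ideal I, upward_closed (fun a => I (msX a)) &
      forall f a, I f -> mscoef f a != 0 -> I (msX a)].
Proof.
move=> [S IS].
have idI : is_ideal I.
  have [G0 GD GM] := is_ideal_gen (fun g : mseries n k => exists2 a, S a & g = msX a).
  by split=> [|f g /IS If /IS Ig|r f /IS If]; apply/IS; [|apply: GD|apply: GM].
have Iup : upward_closed (fun a => I (msX a)).
  by move=> a b Ia; rewrite msXD mulrC; apply: idealM.
split=> // f a /IS If; move: a; apply: (ideal_gen_min (is_ideal_supp Iup)) If.
move=> _ [b Sb ->] a; rewrite mscoef_msX; case: (b =P a) => [<- _|_]; last by rewrite eqxx.
by apply/IS; apply: mem_ideal_gen; exists b.
Qed.

End Monomial.

(** * Jets and strata by order of vanishing *)

Section Jets.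
Variables (n : nat) (k : comNzRingType) (m : nat).
Local Notation jet_ring := {mpoly k[n * m]}.
Local Notation arc := (@jet_arc n k m).
Implicit Types (a b : 'X_{1..n}) (f g : mseries n k) (t : 'I_n -> nat).

Definition weight t a := (\sum_(i < n) t i * a i)%N.

Lemma leq_mdeg_weight t a : (forall i, 0 < t i)%N -> (mdeg a <= weight t a)%N.
Proof. by move=> t_gt0; rewrite mdegE; apply: leq_sum => i _; apply: leq_pmull. Qed.

Lemma leq_weight t a i : (0 < a i)%N -> (t i <= weight t a)%N.
Proof.
move=> ai; rewrite /weight (bigD1 i) //= -[leqLHS]muln1.
by apply: leq_trans (leq_addr _ _); rewrite leq_mul.
Qed.

Lemma jet_coefE j g : jet_coef m j g =
  \sum_(a : 'X_{1..n < m.+1}) (mscoef g a)%:MP * (\prod_(i < n) arc i ^+ a i)`_j.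
Proof. by rewrite /jet_coef /jet_subst coef_sum; apply: eq_bigr => a _; rewrite coefZ. Qed.

Lemma jet_coef_msX j a : (j <= m)%N ->
  jet_coef m j (msX a : mseries n k) = (\prod_(i < n) arc i ^+ a i)`_j.
Proof.
move=> jm; rewrite jet_coefE; have [am|am] := ltnP (mdeg a) m.+1.
  rewrite (bigD1 (BMultinom am)) //= eqxx mpolyC1 mul1r [X in _ + X]big1 ?addr0 // => b nb.
  case: eqP => [ab|_]; last by rewrite mpolyC0 mul0r.
  by case/eqP: nb; apply: val_inj.
rewrite [RHS]jet_monom_coef0 ?(leq_ltn_trans jm) // big1 // => b _ /=.
case: eqP => [ab|_]; last by rewrite mpolyC0 mul0r.
by rewrite jet_monom_coef0 ?mulr0 // -ab (leq_ltn_trans jm).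
Qed.

Lemma coef_jet_arc0 i : (arc i)`_0 = 0.
Proof.
by rewrite coef_sum big1 // => l _; rewrite coefZ coefXn mulr0.
Qed.

(** The ideal of the locus, in the m-jets of I, of the arcs whose i-th
    component has order at least t i.  The coefficient of T^j in [arc i] is
    x_i^(j) for 1 <= j <= m and 0 otherwise, so every value of j may be used
    without side condition. *)
Definition stratum_ideal (I : mseries n k -> Prop) t : jet_ring -> Prop :=
  ideal_gen (fun p =>
    (exists j g, [/\ (j <= m)%N, I g & p = jet_coef m j g]) \/
    (exists i j, (j < t i)%N /\ p = (arc i)`_j)).

Section Stratum.
Variables (I : mseries n k -> Prop).
Local Notation K := (stratum_ideal I).
Let idK t : is_ideal (K t). Proof. exact: is_ideal_gen. Qed.

Lemma jet_arc_congr t i j :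
  K t ((arc i - drop_poly (t i) (arc i) * 'X^(t i))`_j).
Proof.
rewrite coefB coefMXn; case: ltnP => [ji|ij].
  by rewrite subr0; apply: mem_ideal_gen; right; exists i, j.
by rewrite coef_drop_poly subnK // subrr; apply: ideal0.
Qed.

(** On the stratum of t, the arc x_i is T^(t i) times its shift, so x^a is
    divisible by T^(weight t a), with quotient the product of the shifts. *)
Lemma jet_monom_congr t a j :
  K t ((\prod_(i < n) arc i ^+ a i
        - (\prod_(i < n) drop_poly (t i) (arc i) ^+ a i) * 'X^(weight t a))`_j).
Proof.
have -> : (\prod_(i < n) drop_poly (t i) (arc i) ^+ a i) * 'X^(weight t a)
  = \prod_(i < n) (drop_poly (t i) (arc i) * 'X^(t i)) ^+ a i.
  rewrite /weight -prodrXr -big_split /=; apply: eq_bigr => i _.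
  by rewrite exprMn -exprM.
move: j; apply: (ideal_congr_prod (is_ideal_coefs (idK t))) => i.
by apply: (ideal_congrX (is_ideal_coefs (idK t))) => j; apply: jet_arc_congr.
Qed.

Lemma jet_monom_coef_stratum t a j :
  (j < weight t a)%N -> K t (\prod_(i < n) arc i ^+ a i)`_j.
Proof.
by move=> ja; have := jet_monom_congr t a j; rewrite coefB coefMXn ja subr0.
Qed.

Lemma jet_coef_stratum t f j : (j <= m)%N ->
  (forall a, mscoef f a != 0 -> (m < weight t a)%N) -> K t (jet_coef m j f).
Proof.
move=> jm fm; rewrite jet_coefE; apply: (ideal_sum (idK t)) => a _.
have [->|/fm am] := eqVneq (mscoef f a) 0.
  by rewrite mpolyC0 mul0r; apply: ideal0.
by apply: idealM => //; apply: jet_monom_coef_stratum; apply: leq_ltn_trans am.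
Qed.

(** The coefficient of x^a of the least possible order [weight t a] is the
    product of the leading coefficients of the arcs. *)
Lemma stratum_lead t a : I (msX a) -> (weight t a <= m)%N ->
  K t (\prod_(i < n) (arc i)`_(t i) ^+ a i).
Proof.
move=> Ia am; have := jet_monom_congr t a (weight t a).
rewrite coefB coefMXn ltnn subnn -horner_coef0 horner_prod.
under [X in _ - X]eq_bigr do rewrite horner_exp horner_coef0 coef_drop_poly add0n.
move/(ideal_subr (idK t)); apply; rewrite -jet_coef_msX //.
by apply: mem_ideal_gen; left; exists (weight t a), (msX a).
Qed.

Definition raise_order t i : 'I_n -> nat := fun i' => (t i' + (i' == i))%N.

(** Requiring one more order of vanishing of x_i adds a single equation. *)
Lemma stratum_ideal_raise t i p : K (raise_order t i) p -> adjoin (K t) (arc i)`_(t i) p.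
Proof.
apply: ideal_gen_min; first exact: is_ideal_adjoin.
move=> _ [[j [g [jm Ig ->]]]|[i' [j [ji ->]]]].
  by apply: (sub_adjoin); apply: mem_ideal_gen; left; exists j, g.
have [jt|jt] := ltnP j (t i').
  by apply: sub_adjoin; apply: mem_ideal_gen; right; exists i', j.
move: ji jt; rewrite /raise_order; case: eqP => [->|_] + jt; last by rewrite addn0 ltnNge jt.
rewrite addn1 ltnS => jt'; rewrite (@anti_leq j (t i)) ?jt ?jt' //; apply: (mem_adjoin (idK t)).
Qed.

Lemma stratum_ideal_one p : K (fun=> 1%N) p -> jet_ideal (m:=m) I p.
Proof.
apply: ideal_gen_min; first exact: is_ideal_gen.
move=> q [Gq|[i [[|j] [// _ ->]]]]; first exact: mem_ideal_gen.
by rewrite coef_jet_arc0; apply: ideal0 (is_ideal_gen _).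
Qed.

(** Induction on how far t is from exceeding m: a stratum is either
    admissible, or covered by the strata of [raise_order t i] for the variables
    x_i of a monomial of I of weight at most m. *)
Lemma radical_stratum (p : jet_ring) :
  (forall t, (forall i, 0 < t i)%N ->
     (forall a, I (msX a) -> (m < weight t a)%N) -> K t p) ->
  forall t, (forall i, 0 < t i)%N -> exists N, K t (p ^+ N).
Proof.
move=> Kp t; have [d] := ubnP (\sum_(i < n) (m.+1 - t i))%N.
elim: d t => // d IHd t; rewrite ltnS => td t_gt0.
have [[a Ia am]|noa] := pselect (exists2 a, I (msX a) & (weight t a <= m)%N); last first.
  exists 1%N; apply: Kp => // a Ia; rewrite ltnNge; apply/negP => am.
  by apply: noa; exists a.
apply: radical_adjoin_prod (stratum_lead Ia am) => // i ai.
have tim := leq_trans (leq_weight t ai) am.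
have [|j|N KN] := IHd (raise_order t i); last by exists N; apply: stratum_ideal_raise.
  (* The summand of i drops because t i <= m. *)
  apply: leq_trans td; rewrite (bigD1 i) //= [X in (_ < X)%N](bigD1 i) //=.
  rewrite -addSn leq_add //; first by rewrite /raise_order eqxx; lia.
  by apply: leq_sum => j _; rewrite leq_sub2l // leq_addr.
by rewrite addn_gt0 t_gt0.
Qed.

Lemma jet_ideal_radicalP (p : jet_ring) :
  (forall t, (forall i, 0 < t i)%N ->
     (forall a, I (msX a) -> (m < weight t a)%N) -> K t p) ->
  radical (jet_ideal (m:=m) I) p.
Proof.
move=> /radical_stratum/(_ (fun=> 1%N))[] // N KN; exists N.+1 => //.
apply: stratum_ideal_one; rewrite exprS; exact: idealM.
Qed.

End Stratum.
End Jets.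

(** * Specialization to monomial arcs *)

Section MonomialArc.
Variables (n : nat) (k : comNzRingType) (m : nat) (t : 'I_n -> nat).
Hypothesis t_gt0 : forall i, (0 < t i)%N.

(** Specialization of the jet variables to the arc whose i-th component is
    x_i T^(t i); this term is lost by truncation when t i > m. *)
Definition monomial_arc_var : 'I_(n * m) -> {mpoly k[n]} := fun v =>
  mxvec (\matrix_(i < n, l < m) if l.+1 == t i then 'X_i else 0) 0 v.

Definition monomial_arc : {rmorphism {mpoly k[n * m]} -> {mpoly k[n]}} :=
  mmap (@mpolyC n k) monomial_arc_var.

Lemma monomial_arc_jet_arc i :
  map_poly monomial_arc (jet_arc k m i) =
  (if (t i <= m)%N then 'X_i else 0) *: 'X^(t i).
Proof.
rewrite rmorph_sum /=.
under eq_bigr => l _.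
  rewrite map_polyZ map_polyXn /= mmapX mmap1U /monomial_arc_var mxvecE mxE.
  over.
case: leqP => [tm|mt].
  have lt_t : ((t i).-1 < m)%N by rewrite prednK.
  rewrite (bigD1 (Ordinal lt_t)) //= prednK // eqxx big1 ?addr0 // => l nl.
  case: eqP => [tl|]; last by rewrite scale0r.
  by case/eqP: nl; apply: val_inj; rewrite /= -tl.
rewrite scale0r big1 // => l _; case: eqP => [tl|]; last by rewrite scale0r.
by have := ltn_ord l; lia.
Qed.

(** The monomials of g of weight j are sent to themselves, hence cannot
    cancel each other.  A variable x_i whose term is lost has t i > m and does
    not occur in a monomial of weight at most m. *)
Lemma monomial_arc_coef j (g : mseries n k) b : (j <= m)%N ->
  (monomial_arc (jet_coef m j g))@_b = if weight t b == j then mscoef g b else 0.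
Proof.
move=> jm; rewrite jet_coefE rmorph_sum.
have arcE (a : 'X_{1..n}) : monomial_arc (\prod_(i < n) jet_arc k m i ^+ a i)`_j =
    if weight t a == j then 'X_[a] else 0.
  rewrite -coef_map rmorph_prod /=.
  under eq_bigr do rewrite rmorphXn /= monomial_arc_jet_arc exprZn -exprM.
  rewrite scaler_prod prodrXr coefZ coefXn eq_sym -/(weight t a).
  case: eqP => [aj|_]; last by rewrite mulr0.
  rewrite mulr1 mpolyXE_id; apply: eq_bigr => i _.
  have [->|/leq_weight ai] := posnP (a i); first by rewrite !expr0.
  by rewrite (leq_trans (ai t)) ?aj.
rewrite (eq_bigr (fun a : 'X_{1..n < m.+1} =>
    if weight t a == j then mscoef g a *: 'X_[a] else 0)) => [|a _]; last first.
  by rewrite rmorphM /= arcE mmapC mul_mpolyC; case: eqP; rewrite ?scaler0.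
rewrite raddf_sum /=.
case: eqP => [bj|nbj]; last first.
  rewrite big1 // => a _; case: eqP => [aj|_]; last by rewrite mcoeff0.
  rewrite mcoeffZ mcoeffX; case: eqP => [ab|_]; last by rewrite mulr0.
  by rewrite ab in aj.
have bm : (mdeg b < m.+1)%N by rewrite ltnS (leq_trans (leq_mdeg_weight b t_gt0)) ?bj.
rewrite (bigD1 (BMultinom bm)) //= bj eqxx mcoeffZ mcoeffX eqxx mulr1.
rewrite big1 ?addr0 // => a nab; case: ifP => _; last by rewrite mcoeff0.
rewrite mcoeffZ mcoeffX; case: eqP => [ab|_]; last by rewrite mulr0.
by case/eqP: nab; apply: val_inj.
Qed.

End MonomialArc.

(** * The jet support closure *)

Section Closure.
Variables (n : nat) (k : idomainType) (m : nat) (I : mseries n k -> Prop).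
Hypothesis monI : monomial_ideal I.

Definition jsc_monomial (b : 'X_{1..n}) : Prop :=
  forall t : 'I_n -> nat, (forall i, (0 < t i)%N) -> (weight t b <= m)%N ->
    exists2 a, I (msX a) & (weight t a <= m)%N.

(** The first direction evaluates at the monomial arc of an admissible t, and
    the second uses the covering of the jets of I by the admissible strata. *)
Lemma jet_support_closure_supp (f : mseries n k) :
  jet_support_closure m I f <-> (forall b, mscoef f b != 0 -> jsc_monomial b).
Proof.
have [_ _ suppI] := monomial_ideal_supp monI.
split=> [If b fb t t_gt0 bm|Bf j jm].
  apply: contrapT => noa.
  have a_gt a : I (msX a) -> (m < weight t a)%N.
    by move=> Ia; rewrite ltnNge; apply/negP => am; apply: noa; exists a.
  pose psi := monomial_arc k m t.
  have psiI p : jet_ideal (m:=m) I p -> psi p = 0.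
    apply: (ideal_gen_min (is_ideal_ker psi)) => _ [j [g [jm Ig ->]]].
    apply/mpolyP => a; rewrite monomial_arc_coef // mcoeff0.
    case: eqP => // aj; apply: contraTeq jm => /(suppI _ _ Ig)/a_gt.
    by rewrite aj -ltnNge.
  have [N N_gt0 /psiI] := If _ bm.
  rewrite rmorphXn => /eqP; rewrite expf_eq0 N_gt0 /= => /eqP.
  move=> /(congr1 (mcoeff b)); rewrite monomial_arc_coef // mcoeff0 eqxx => f0.
  by rewrite f0 eqxx in fb.
apply: jet_ideal_radicalP => t t_gt0 ta; apply: jet_coef_stratum => // b /Bf Bb.
rewrite ltnNge; apply/negP => /(Bb t t_gt0)[a /ta].
by rewrite ltnNge => /negP.
Qed.

Lemma jsc_monomial_up : upward_closed jsc_monomial.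
Proof.
move=> a b Ba t t_gt0 abm; apply: Ba => //; apply: leq_trans abm.
by apply: leq_sum => i _; rewrite mnmDE leq_mul ?leq_addr.
Qed.

(** Holds vacuously, as the weight is at least the degree. *)
Lemma jsc_monomial_mdeg b : mdeg b = m.+1 -> jsc_monomial b.
Proof.
move=> bm t t_gt0 /(leq_trans (leq_mdeg_weight b t_gt0)).
by rewrite bm ltnn.
Qed.

End Closure.

Theorem theoremC (k : closedFieldType) (char0 : [pchar k] =i pred0)
    (n m : nat) (I : mseries n k -> Prop) (monI : monomial_ideal I) :
  monomial_ideal (jet_support_closure m I) /\
  (forall b : 'X_{1..n},
     jet_support_closure m I (msX b) <->
     (forall t : 'I_n -> nat,
        (forall i, (0 < t i)%N) ->
        (\sum_(i < n) t i * b i <= m)%N ->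
        exists2 a : 'X_{1..n},
          I (msX a) & (\sum_(i < n) t i * a i <= m)%N)).
Proof.
split=> [|b].
  exists (jsc_monomial m I) => f.
  apply: iff_trans (jet_support_closure_supp m monI f) _.
  exact: (supp_ideal_gen f (@jsc_monomial_up _ _ m I) (@jsc_monomial_mdeg _ _ m I)).
apply: iff_trans (jet_support_closure_supp m monI _) _; split=> [|Bb a].
  by apply; rewrite mscoef_msX eqxx oner_neq0.
by rewrite mscoef_msX; case: (b =P a) => [<-|_]; rewrite ?eqxx.
Qed.
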